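(* Let $m\ge 1$ and $d\ge 2$, let $p_1,\dots,p_m\in(0,1]$, and let $\pi=(\pi^1,\dots,\pi^m):\triangle^m\to\triangle^m$ be such that the vector field $F:\triangle^m\to\mathbb{R}^{md}$, $F(x)=-x+\pi(x)$, is Lipschitz continuous. Let $W(n)=(W^1(n),\dots,W^m(n))$, $n\ge 0$, be the system of $m$ interacting vertex-reinforced random walks on $\{1,\dots,d\}$ with geometric inter-transition times of parameters $p_1,\dots,p_m$ described in the context, and let $\xi(n)$ and $X(n)$ be its visit-indicator vector and its vector of vertex-occupation proportions. For $n\ge 0$ put $$\gamma_n=\frac{1}{n+2},\qquad U(n+1)=\xi(n+1)-\pi(X(n))\in\mathbb{R}^{md},$$ and let $t_0=0$, $t_n=\sum_{k=0}^{n-1}\gamma_k$ for $n\ge 1$. Then for every $T>0$, $$\lim_{n\to\infty}\left(\sup_{r:\ 0\le t_r-t_n\le T}\left\|\sum_{k=n}^{r-1}\gamma_k\,U(k)\right\|\right)=0\qquad\text{almost surely},$$ where $n\ge 1$, the supremum is over integers $r$, and the sum is $0$ when $r=n$.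
   Context: Notation: $\triangle=\{y\in[0,1]^d:\sum_{v=1}^d y_v=1\}$ is the $(d-1)$-dimensional simplex, $\triangle^m\subset\mathbb{R}^{md}$ is its $m$-fold product, and $\|y\|=\sum_j|y_j|$ is the sum-of-absolute-values norm. For $x\in\triangle^m$ write $\pi(x)=(\pi^1(x),\dots,\pi^m(x))$ with $\pi^i(x)=(\pi^i_1(x),\dots,\pi^i_d(x))\in\triangle$. The model: there are $m$ walks on the complete graph with vertex set $\{1,\dots,d\}$; $W^i(n)\in\{1,\dots,d\}$ is the position of walk $i$ at time $n=0,1,2,\dots$. The initial positions $W^1(0),\dots,W^m(0)$ are independent with $\mathbb{P}(W^i(0)=v)=\alpha^i_v$, where $\alpha=(\alpha^1,\dots,\alpha^m)\in\triangle^m$ is a parameter. Set $$\xi^i_v(n)=\mathbf{1}\{W^i(n)=v\},\qquad X^i_v(n)=\frac{1}{n+1}\sum_{\ell=0}^n\xi^i_v(\ell),$$ $\xi(n)=(\xi^i_v(n))_{1\le i\le m,\,1\le v\le d}\in\triangle^m$ and $X(n)=(X^i_v(n))_{1\le i\le m,\,1\le v\le d}\in\triangle^m$ (both ordered as $(1,1),\dots,(1,d),\dots,(m,1),\dots,(m,d)$). Let $\mathcal{F}_n$ be the sigma-algebra generated by $W(0),\dots,W(n)$. Dynamics: for each $i$, let $G^i_1,G^i_2,\dots$ be i.i.d. geometric random variables on $\{1,2,\dots\}$ with parameter $p_i$, the $m$ sequences being independent, and let $\tau^i_0=0$, $\tau^i_k=G^i_1+\dots+G^i_k$ be the transition times of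 walk $i$. The position $W^i(n)$ is constant for $\tau^i_{k-1}<n\le\tau^i_k$; a move from time $n$ to time $n+1$ is possible only when $n=\tau^i_k$ for some $k\ge 1$, and then, given the past, the next position $W^i(n+1)$ equals $v$ with probability $\pi^i_v(X(n))$. Thus, for all $n\ge 1$, all $i$ and all $v$, $$\mathbb{P}\big(W^i(n+1)=v\mid\mathcal{F}_n\big)=q^i_{W^i(n),v}(X(n),p_i),$$ where $$q^i_{wv}(x,p_i)=p_i\,\pi^i_v(x)\ \text{ if } v\ne w,\qquad q^i_{ww}(x,p_i)=1-p_i\sum_{k\ne w}\pi^i_k(x).$$ *)

(* Defs.v *)
From HB Require Import structures.
From mathcomp Require Import all_boot all_order all_algebra.
From mathcomp Require Import all_classical all_reals all_analysis.
Set Implicit Arguments.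
Unset Strict Implicit.
Unset Printing Implicit Defensive.
Import Order.TTheory GRing.Theory Num.Theory.
Import numFieldNormedType.Exports.

Local Open Scope classical_set_scope.
Local Open Scope ring_scope.

(* A point of R^(m d) is a matrix x : 'M[R]_(m, d); x i v is the v-th coordinate
   of the i-th block. *)

(* The library norm on matrices is the max norm, hence this definition. *)
Definition norm1 (R : realType) (m d : nat) (x : 'M[R]_(m, d)) : R :=
  \sum_i \sum_v `|x i v|.

Definition simplex_prod (R : realType) (m d : nat) : set 'M[R]_(m, d) :=
  [set x | forall i, (forall v, 0 <= x i v <= 1) /\ \sum_v x i v = 1].

Definition lipschitz1_on (R : realType) (m d : nat) (A : set 'M[R]_(m, d))
    (F : 'M[R]_(m, d) -> 'M[R]_(m, d)) : Prop :=
  exists L : R, forall x y, A x -> A y ->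
    norm1 (F x - F y) <= L * norm1 (x - y).

Definition drift (R : realType) (m d : nat) (pi : 'M[R]_(m, d) -> 'M[R]_(m, d))
  : 'M[R]_(m, d) -> 'M[R]_(m, d) := fun x => - x + pi x.

(* Mutual independence of a family of random elements of a countable set E
   carrying the discrete sigma-algebra, so that every B i is measurable. *)
Definition mutually_independent (disp : measure_display)
    (Omega : measurableType disp) (R : realType) (P : probability Omega R)
    (I : eqType) (E : Type) (Y : I -> Omega -> E) : Prop :=
  forall (s : seq I) (B : I -> set E), uniq s ->
    P (\big[setI/setT]_(i <- s) (Y i @^-1` B i)) =
    (\prod_(i <- s) P (Y i @^-1` B i))%E.

Section Walks.
Context (disp : measure_display) (Omega : measurableType disp) (m d : nat).
(* W i n : position of walk i at time n.
   G i k : the (k+1)-st inter-transition time of walk i (numbered from 0). *)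
Variables (W : 'I_m -> nat -> Omega -> 'I_d) (G : 'I_m -> nat -> Omega -> nat).

Definition transition_time (i : 'I_m) (k : nat) (omega : Omega) : nat :=
  (\sum_(j < k) G i j omega)%N.

Definition transition_at (i : 'I_m) (n : nat) : set Omega :=
  [set omega | exists2 k, (1 <= k)%N & transition_time i k omega = n].

(* The past at time n is generated by the positions at times 0, ..., n and by
   the events "l is a transition time of walk j" for l <= n.  It is a finite
   sigma-algebra; [history n omega] is its atom containing omega. *)
Definition history (n : nat) (omega : Omega) : set Omega :=
  [set omega' | forall (j : 'I_m) (l : nat), (l <= n)%N ->
     W j l omega' = W j l omega /\
     (transition_at j l omega' <-> transition_at j l omega)].

Definition positions (n : nat) (w : 'I_m -> 'I_d) : set Omega :=
  [set omega | forall j, W j n omega = w j].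

Definition clock_events : set (set Omega) :=
  <<s [set A | exists (j : 'I_m) (k g : nat),
                 A = [set omega | G j k omega = g]] >>.

Definition visits (R : realType) (n : nat) (omega : Omega) : 'M[R]_(m, d) :=
  \matrix_(i < m, v < d) (W i n omega == v)%:R.

Definition occupation (R : realType) (n : nat) (omega : Omega)
  : 'M[R]_(m, d) :=
  (n.+1%:R)^-1 *: \sum_(l < n.+1) visits R l omega.

(* Conditional statements given the past are written with elementary
   conditional probabilities on the atoms [history n omega], multiplied out so
   that atoms of probability 0 carry no constraint.  Only the marginal
   conditional laws of the next positions are prescribed: nothing is assumed
   about their joint conditional law, except that it involves the clocks only
   through the past (vrrw_step_clocks). *)
Record interacting_vrrw (R : realType) (P : probability Omega R)
    (alpha : 'M[R]_(m, d)) (p : 'I_m -> R)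
    (pi : 'M[R]_(m, d) -> 'M[R]_(m, d)) : Prop := InteractingVRRW {
  vrrw_measurableW : forall i n v, measurable [set omega | W i n omega = v];
  vrrw_measurableG : forall i k g, measurable [set omega | G i k omega = g];

  vrrw_init_law : forall i v,
    P [set omega | W i 0%N omega = v] = (alpha i v)%:E;
  vrrw_init_indep : mutually_independent P (fun i => W i 0%N);

  vrrw_clock_pos : forall i k omega, (0 < G i k omega)%N;
  vrrw_clock_law : forall i k g,
    P [set omega | G i k omega = g.+1] = (p i * (1 - p i) ^+ g)%:E;
  vrrw_clock_indep :
    mutually_independent P (fun ik : 'I_m * nat => G ik.1 ik.2);

  vrrw_stay : forall i n omega,
    ~ transition_at i n omega -> W i n.+1 omega = W i n omega;
  vrrw_move : forall i n omega v, transition_at i n omega ->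
    P ([set omega' | W i n.+1 omega' = v] `&` history n omega) =
    ((pi (occupation R n omega) i v)%:E * P (history n omega))%E;

  (* The clocks run autonomously: W(0) is independent of them and, given the
     past at time n, W(n+1) is conditionally independent of them. *)
  vrrw_init_clocks : forall w C, clock_events C ->
    P (positions 0 w `&` C) = (P (positions 0 w) * P C)%E;
  vrrw_step_clocks : forall n omega w C, clock_events C ->
    (P (positions n.+1 w `&` history n omega `&` C) * P (history n omega) =
     P (positions n.+1 w `&` history n omega) * P (history n omega `&` C))%E
}.

(* U(n) for n >= 1; the value at n = 0 is irrelevant. *)
Definition noise (R : realType) (pi : 'M[R]_(m, d) -> 'M[R]_(m, d))
    (n : nat) (omega : Omega) : 'M[R]_(m, d) :=
  visits R n omega - pi (occupation R n.-1 omega).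

End Walks.

Definition step_size (R : realType) (n : nat) : R := (n.+2%:R)^-1.

Definition step_time (R : realType) (n : nat) : R :=
  \sum_(0 <= k < n) step_size R k.

(* Main.v *)
Require Import Defs.
From HB Require Import structures.
From mathcomp Require Import all_boot all_order all_algebra.
From mathcomp Require Import all_classical all_reals all_analysis.
From mathcomp Require Import measurable_realfun.
From mathcomp Require Import ring lra zify.
Set Implicit Arguments.
Unset Strict Implicit.
Unset Printing Implicit Defensive.
Import Order.TTheory GRing.Theory Num.Theory.
Import numFieldNormedType.Exports.

Local Open Scope classical_set_scope.
Local Open Scope ring_scope.

(** The whole series of the vectors [gamma_k U(k)] converges almost surely, so
    its sections of any length, in particular those of duration at most [T],
    tend to zero uniformly ([sup_tails_cvg0]).

    Fix a walk [i] and a vertex [v], and write [xi n] for the indicator of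
    [W i n = v] and [q n] for the [v]-th coordinate of [pi^i] at the occupation
    proportions at time [n].  Given the positions up to time [n >= 1], the walk
    is at [v] at time [n + 1] with probability
    [p_i q n + (1 - p_i) xi n] ([step_given_walks]).  Hence the innovations
    [I n = xi (n + 1) - (1 - p_i) xi n - p_i q n] are bounded martingale
    differences, and
    [p_i U(n + 1) = I n - (1 - p_i) (xi (n + 1) - xi n)].  The last term
    telescopes: with the decreasing weights [gamma] it gives a convergent series
    by summation by parts ([cvg_series_weighted_increments]).  The terms
    [gamma_(n + 1) I n] are orthogonal and of order [1 / n], and such a series
    converges almost surely ([ae_cvg_orthogonal_series]): along the cubes this
    is a matter of second moments, and between consecutive cubes the partial
    sums can only move by [O(1 / j)].

    The transition probabilities must be recovered from the clocks.  The history
    of the walks constrains the clocks only through the transitions already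
    seen ([history_clock_factor]); these amount to the completed waiting times
    and a lower bound on the current one ([renewals_upto]); and since the
    waiting times are independent and geometric, hence memoryless, a transition
    happens next with probability [p_i] ([clock_atom_next], [transition_given_history]).
    Averaging over the unobserved transition flags then gives
    [step_given_walks]. *)

(** * Discrete random elements *)

(** Both the events of the probability space and the clock events are used
    below, hence a sigma-algebra given by its events. *)
Definition discrete_in (T E : Type) (S : set (set T)) (f : T -> E) : Prop :=
  forall e, S (f @^-1` [set e]).

Section DiscreteElements.
Context (T : Type) (S : set (set T)) (hS : sigma_algebra setT S).

Lemma sigma_setI A B : S A -> S B -> S (A `&` B).
Proof.
by have [_ _ _ +] := proj1 (sigma_algebraP (fun X _ => @subsetT _ X)) hS; apply.
Qed.

Lemma sigma_setC A : S A -> S (~` A).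
Proof. by case: hS => _ + _ => /[apply]; rewrite setTD. Qed.

Lemma sigma_setT : S setT.
Proof. by rewrite -setC0; apply: sigma_setC; case: hS. Qed.

Lemma discrete_preimage (E : countType) (f : T -> E) (B : set E) :
  discrete_in S f -> S (f @^-1` B).
Proof.
move=> hf; case: hS => S0 _ Scup.
pose F n := if unpickle n is Some e then
  (if `[< B e >] then f @^-1` [set e] else set0) else set0.
rewrite (_ : _ @^-1` _ = \bigcup_n F n).
  by apply: Scup => n; rewrite /F; case: unpickle => // e; case: asboolP.
apply/seteqP; split => [t Bt|t [n _]]; rewrite /F.
  by exists (pickle (f t)) => //; rewrite pickleK; case: asboolP.
by case: unpickle => // e; case: asboolP => // Be /= ->.
Qed.

Lemma discrete_saturated (E : countType) (E' : Type)
    (f : T -> E) (g : T -> E') :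
  discrete_in S f -> (forall s t, f s = f t -> g s = g t) ->
  forall B : set E', S (g @^-1` B).
Proof.
move=> hf fg B; rewrite (_ : _ @^-1` _ = f @^-1` (f @` (g @^-1` B))).
  exact: discrete_preimage.
apply/seteqP; split => [t Bt|t [s Bs /fg st]]; first by exists t.
by rewrite /= -st.
Qed.

Lemma discrete_pair (E E' : Type) (f : T -> E) (g : T -> E') :
  discrete_in S f -> discrete_in S g -> discrete_in S (fun t => (f t, g t)).
Proof.
move=> hf hg [e e'].
rewrite (_ : _ @^-1` _ = (f @^-1` [set e]) `&` (g @^-1` [set e'])).
  exact: sigma_setI.
by apply/seteqP; split => [t [<- <-]|t [/= <- <-]].
Qed.

Lemma discrete_ffun (I : finType) (E : Type) (f : I -> T -> E) :
  (forall i, discrete_in S (f i)) ->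
  discrete_in S (fun t => [ffun i => f i t] : {ffun I -> E}).
Proof.
move=> hf c.
rewrite (_ : _ @^-1` _ = \big[setI/setT]_(i : I) (f i @^-1` [set c i])).
  elim/big_ind: _ => [|A B|i _].
  - exact: sigma_setT.
  - exact: sigma_setI.
  - exact: hf.
rewrite -bigcap_seq; apply/seteqP; split => [t /= <- i _|t /= h].
  by rewrite /= ffunE.
by apply/ffunP => i; rewrite ffunE; apply: h; rewrite /= mem_index_enum.
Qed.

End DiscreteElements.

Section FiniteProbability.
Context (disp : measure_display) (Omega : measurableType disp) (R : realType)
  (P : probability Omega R).

(** Events have finite probabilities: products and quotients of them are taken
    in [R], away from the conventions on infinite values. *)
Definition prob (A : set Omega) : R := fine (P A).

Lemma probE A : measurable A -> P A = (prob A)%:E.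
Proof. by move=> mA; rewrite /prob fineK// fin_num_measure. Qed.

Lemma prob_ge0 A : 0 <= prob A.
Proof. exact: fine_ge0. Qed.

Lemma prob_set0 : prob set0 = 0.
Proof. by rewrite /prob measure0. Qed.

Lemma prob_eq A r : P A = r%:E -> prob A = r.
Proof. by rewrite /prob => ->. Qed.

Lemma prob_eq0S A B : measurable A -> measurable B -> A `<=` B ->
  prob B = 0 -> prob A = 0.
Proof.
move=> mA mB AB B0; apply/eqP; rewrite eq_le prob_ge0 andbT -B0 -lee_fin.
by rewrite -!probE// le_measure ?inE.
Qed.

Lemma probDI A B : measurable A -> measurable B ->
  prob A = prob (A `&` B) + prob (A `&` ~` B).
Proof.
move=> mA mB; apply/EFin_inj; rewrite EFinD -!probE//; last 2 first.
- by apply: measurableI => //; exact: measurableC.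
- exact: measurableI.
by rewrite -setDE addeC; exact: measureDI.
Qed.

Lemma bounded_integrable (D : set Omega) (f : Omega -> R) (M : R) :
  measurable D -> measurable_fun setT f -> (forall t, `|f t| <= M) ->
  P.-integrable D (EFin \o f).
Proof.
move=> mD mf fM; apply: measurable_bounded_integrable => //.
- by apply: le_lt_trans (probability_le1 P mD) _; rewrite ltry.
- exact: measurable_funTS.
- exists M; split; first by rewrite num_real.
  by move=> x Mx t _ /=; rewrite (le_trans (fM t))// ltW.
Qed.

Lemma fibre_cover (E : finType) (f : Omega -> E) :
  \big[setU/set0]_(e <- enum E) (f @^-1` [set e]) = setT.
Proof.
rewrite -bigcup_seq; apply/seteqP; split => // t _.
by exists (f t) => //; rewrite /= mem_enum.
Qed.

Lemma fibre_trivIset (E : finType) (f : Omega -> E) (D : set E) :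
  trivIset D (fun e => f @^-1` [set e]).
Proof. by move=> e e' _ _ [t [/= <- <-]]. Qed.

Lemma Rintegral_fibres (E : finType) (h : Omega -> E) (f : Omega -> R) :
  discrete_in measurable h -> measurable_fun setT f ->
  (exists M, forall t, `|f t| <= M) ->
  \int[P]_t f t = \sum_e \int[P]_(t in h @^-1` [set e]) f t.
Proof.
move=> hh mf [M fM].
rewrite /Rintegral -[in LHS](fibre_cover h) integral_bigsetU_EFin//=.
- rewrite big_enum/= -sum_fine// => e _; apply: integrable_fin_num => //.
  exact: (bounded_integrable _ mf fM).
- exact: enum_uniq.
- exact: fibre_trivIset.
- by rewrite fibre_cover; exact/measurable_EFinP.
Qed.

Lemma Rintegral_indic (A D : set Omega) : measurable A -> measurable D ->
  \int[P]_(t in D) (\1_A t : R) = prob (A `&` D).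
Proof. by move=> mA mD; rewrite /Rintegral integral_indic. Qed.

Lemma indic_le1 (A : set Omega) t : `|\1_A t : R| <= 1.
Proof. by rewrite indicE; case: (_ \in _); rewrite ?normr1 ?normr0. Qed.

Lemma prob_fibres (E : finType) (h : Omega -> E) (A : set Omega) :
  discrete_in measurable h -> measurable A ->
  prob A = \sum_e prob (A `&` h @^-1` [set e]).
Proof.
move=> hh mA.
rewrite -[in LHS](setIT A) -Rintegral_indic// (Rintegral_fibres hh).
- by apply: eq_bigr => e _; rewrite Rintegral_indic.
- exact: measurable_indic.
- by exists 1 => t; exact: indic_le1.
Qed.

(** Given the value of [h], the factor [Z] is a constant and [D] averages to
    zero: this is the orthogonality of martingale differences. *)
Lemma Rintegral_mul_eq0 (E : finType) (h : Omega -> E) (Z D : Omega -> R) :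
  discrete_in measurable h ->
  measurable_fun setT D -> (exists M, forall t, `|D t| <= M) ->
  measurable_fun setT Z -> (exists M, forall t, `|Z t| <= M) ->
  (forall s t, h s = h t -> Z s = Z t) ->
  (forall e, \int[P]_(t in h @^-1` [set e]) D t = 0) ->
  \int[P]_t (Z t * D t) = 0.
Proof.
move=> hh mD [M DM] mZ [K ZK] Zh D0; rewrite (Rintegral_fibres hh).
- apply: big1 => e _.
  have [[s hs]|ne] := pselect (exists s, h s = e); last first.
    rewrite (_ : _ @^-1` _ = set0) ?Rintegral_set0//.
    by apply/seteqP; split => // t /= ht; apply: ne; exists t.
  rewrite (eq_Rintegral _ (g := fun t => Z s * D t)); last first.
    by move=> t /[1!inE] /= ht; rewrite (Zh t s)// hs ht.
  rewrite RintegralZl// ?D0 ?mulr0//.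
  exact: (bounded_integrable _ mD DM).
- exact: measurable_funM.
- exists (K * M) => t; rewrite normrM ler_pM//.
Qed.

End FiniteProbability.

(** * Series of orthogonal random variables *)

Section CubicBlocks.
Context (R : realType).

Lemma cube_lower (j : nat) : (j.+1 ^ 3)%:R <= 4 * (j ^ 3).+1%:R :> R.
Proof.
rewrite -[4]/(4%:R) -natrM ler_nat.
by rewrite !expnS !expn0 !muln1; case: j => // j; nia.
Qed.

Lemma cube_gap (j : nat) :
  (j.+1 ^ 3 - j ^ 3)%:R / (j ^ 3).+1%:R <= 12 / j.+1%:R :> R.
Proof.
rewrite ler_pdivrMr ?ltr0n// mulrAC ler_pdivlMr ?ltr0n//.
rewrite -[12]/(12%:R) -!natrM ler_nat.
have -> : (j.+1 ^ 3 - j ^ 3 = 3 * j ^ 2 + 3 * j + 1)%N.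
  by rewrite !expnS !expn0 !muln1; lia.
by rewrite !expnS !expn0 !muln1; case: j => // j; nia.
Qed.

Lemma cube_between (n : nat) : exists j, (j ^ 3 <= n < j.+1 ^ 3)%N.
Proof.
elim: n => [|n [j /andP[jn nj]]]; first by exists 0%N.
move: nj; rewrite leq_eqVlt => /orP[/eqP nj|nj].
  by exists j.+1; rewrite nj leqnn/= ltn_exp2r.
by exists j; rewrite nj andbT ltnW.
Qed.

Lemma sum_inverse_square N : \sum_(0 <= j < N) (j.+1%:R ^- 2 : R) <= 2.
Proof.
apply: le_trans (_ : 2 - 2 / N.+1%:R <= _); last first.
  by rewrite gerBl divr_ge0.
elim: N => [|N IH]; first by rewrite big_geq// divr1 subrr.
rewrite big_nat_recr//=; apply: le_trans (lerD IH (lexx _)) _.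
rewrite -subr_ge0.
have -> : N.+2%:R = N.+1%:R + 1 :> R by rewrite natr1.
have : 1 <= N.+1%:R :> R by rewrite ler1n.
move: (N.+1%:R : R) => x x1.
have -> : 2 - 2 / (x + 1) - (2 - 2 / x + x ^- 2) = (x - 1) / (x ^+ 2 * (x + 1)).
  by field; apply/andP; split; lra.
rewrite divr_ge0 ?subr_ge0// mulr_ge0 ?exprn_ge0//; lra.
Qed.

Lemma norm_block_le (u : nat -> R) (M : R) a b : (a <= b)%N ->
  (forall k, `|u k| <= M / k.+1%:R) ->
  `|\sum_(a <= k < b) u k| <= M * ((b - a)%:R / a.+1%:R).
Proof.
move=> ab hu.
have M0 : 0 <= M by have := hu 0%N; rewrite divr1; apply: le_trans.
apply: le_trans (ler_norm_sum _ _ _) _.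
apply: le_trans (_ : \sum_(a <= k < b) M / a.+1%:R <= _); last first.
  by rewrite sumr_const_nat -[_ *+ (b - a)]mulr_natr mulrAC mulrA.
rewrite !big_nat; apply: ler_sum => k /andP[ak _].
apply: le_trans (hu k) _; rewrite ler_wpM2l// lef_pV2 ?posrE ?ltr0n//.
by rewrite ler_nat ltnS.
Qed.

(** Consecutive cubes are close enough for terms of order [1 / k] to sum up to
    [O(1 / j)] between them. *)
Lemma cvg_series_cubes (u : nat -> R) (M : R) :
  (forall k, `|u k| <= M / k.+1%:R) ->
  cvgn (series (fun j => \sum_(j ^ 3 <= k < j.+1 ^ 3) u k)) ->
  cvgn (series u).
Proof.
move=> hu /cvg_ex[l hl]; apply/cvg_ex; exists l.
have M0 : 0 <= M by have := hu 0%N; rewrite divr1; apply: le_trans.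
have cube j : series (fun j => \sum_(j ^ 3 <= k < j.+1 ^ 3) u k) j =
    \sum_(0 <= k < j ^ 3) u k.
  elim: j => [|j IH]; first by rewrite /series/= !big_geq.
  rewrite /series/= big_nat_recr//= -[X in X + _]/(series _ j) IH.
  rewrite -big_cat_nat//.
  by rewrite leq_exp2r.
apply/cvgrPdist_le => e e0.
have e2 : 0 < e / 2 by rewrite divr_gt0.
move/cvgrPdist_le/(_ _ e2) : hl => [J1 _ hJ1].
(* beyond this index the blocks move the partial sums by at most e / 2 *)
pose J2 := Num.bound (12 * M / (e / 2)).
exists ((maxn J1 J2) ^ 3)%N => // n /= Jn.
have [j /andP[jn nj]] := cube_between n.
have : (maxn J1 J2 <= j)%N.
  by rewrite -ltnS -(@ltn_exp2r _ _ 3)// (leq_ltn_trans Jn).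
rewrite geq_max => /andP[J1j J2j].
have := hJ1 j J1j; rewrite /= cube => h1.
have -> : series u n = \sum_(0 <= k < j ^ 3) u k + \sum_(j ^ 3 <= k < n) u k.
  by rewrite -big_cat_nat.
rewrite opprD addrA [e]splitr; apply: le_trans (ler_normB _ _) (lerD h1 _).
apply: le_trans (norm_block_le jn hu) _.
apply: le_trans (_ : M * (12 / j.+1%:R) <= _).
  rewrite ler_wpM2l//; apply: le_trans (cube_gap j).
  rewrite ler_wpM2r ?invr_ge0// ler_nat; apply: leq_sub2r.
  exact: ltnW.
rewrite mulrCA mulrA ler_pdivrMr ?ltr0n// [_ / 2 * _]mulrC -ler_pdivrMr//.
have : 12 * M / (e / 2) < J2%:R.
  by apply: archi_boundP; rewrite divr_ge0 ?mulr_ge0// ltW.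
move=> /ltW/le_trans; apply; rewrite ler_nat; exact: leqW.
Qed.

(** Take [a = 1 / (j + 1) ^ 2] in [`|x| <= a + x ^ 2 / a]. *)
Lemma cvg_series_weighted_squares (u : nat -> R) (B : R) :
  (forall N, \sum_(0 <= j < N) j.+1%:R ^+ 2 * u j ^+ 2 <= B) ->
  cvgn (series u).
Proof.
move=> hB; apply: normed_cvg; apply: nondecreasing_is_cvgn.
  by apply: (@nondecreasing_series _ _ xpredT 0) => n _ _ /=.
exists (2 + B) => _ [N _ <-]; rewrite /series/=.
apply: le_trans (lerD (sum_inverse_square N) (hB N)).
rewrite -big_split/=; apply: ler_sum => j _.
set w := j.+1%:R ^+ 2; have w0 : 0 < w :> R by rewrite exprn_gt0// ltr0n.
rewrite -subr_ge0 -(pmulr_rge0 _ w0) mulrBr mulrDr divff ?gt_eqF//.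
rewrite -[u j ^+ 2]real_normK ?num_real//.
(* w |u| <= 1 + (w |u|)^2, multiplied through by w *)
have : 0 <= (w * `|u j| - 1 / 2) ^+ 2 by exact: sqr_ge0.
nra.
Qed.

End CubicBlocks.

Section OrthogonalSeries.
Context (disp : measure_display) (Omega : measurableType disp) (R : realType)
  (P : probability Omega R).
Context (Y : nat -> Omega -> R) (M : R).
Hypotheses (M0 : 0 <= M) (mY : forall k, measurable_fun setT (Y k))
  (YM : forall k t, `|Y k t| <= M / k.+1%:R)
  (Yorth : forall k n, (k < n)%N -> \int[P]_t (Y k t * Y n t) = 0).

Let block a b t := \sum_(a <= k < b) Y k t.

Local Lemma measurable_block a b : measurable_fun setT (block a b).
Proof. exact: measurable_sum. Qed.

Local Lemma bounded_term k : exists M, forall t, `|Y k t| <= M.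
Proof. by exists (M / k.+1%:R) => t; exact: YM. Qed.

Local Lemma bounded_block a b : exists K, forall t, `|block a b t| <= K.
Proof.
exists (\sum_(a <= k < b) M / k.+1%:R) => t.
apply: le_trans (ler_norm_sum _ _ _) _.
by apply: ler_sum => k _; exact: YM.
Qed.

Local Lemma integrable_boundedM (f g : Omega -> R) :
  measurable_fun setT f -> (exists K, forall t, `|f t| <= K) ->
  measurable_fun setT g -> (exists K, forall t, `|g t| <= K) ->
  P.-integrable setT (EFin \o (fun t => f t * g t)).
Proof.
move=> mf [K fK] mg [L gL].
apply: (bounded_integrable (M := K * L) P measurableT).
  exact: measurable_funM.
by move=> t; rewrite normrM ler_pM.
Qed.

Local Lemma integrable_block_square a b :
  P.-integrable setT (EFin \o (fun t => block a b t ^+ 2)).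
Proof.
under eq_fun do rewrite expr2.
apply: integrable_boundedM; [exact: measurable_block|exact: bounded_block|..].
  exact: measurable_block.
exact: bounded_block.
Qed.

Local Lemma block_empty a b t : (b <= a)%N -> block a b t = 0.
Proof. by move=> ba; rewrite /block big_geq. Qed.

Local Lemma block_orthogonal a b n : (b <= n)%N ->
  \int[P]_t (block a b t * Y n t) = 0.
Proof.
have empty c : (c <= a)%N -> \int[P]_t (block a c t * Y n t) = 0.
  move=> ca; under eq_Rintegral do rewrite block_empty// mul0r.
  by rewrite Rintegral_cst// mul0r.
elim: b => [_|b IH bn]; first exact: empty.
have [ba|ab] := ltnP b a; first exact: empty.
under eq_Rintegral do rewrite /block big_nat_recr//= mulrDl.
rewrite RintegralD//.
- by rewrite Yorth// addr0 IH// ltnW.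
- apply: integrable_boundedM; [exact: measurable_block|exact: bounded_block|..].
    exact: mY.
  exact: bounded_term.
- apply: integrable_boundedM; [exact: mY|exact: bounded_term|exact: mY|].
  exact: bounded_term.
Qed.

Local Lemma block_second_moment a b :
  \int[P]_t (block a b t ^+ 2) <= (b - a)%:R * (M / a.+1%:R) ^+ 2.
Proof.
have empty c : (c <= a)%N ->
    \int[P]_t (block a c t ^+ 2) <= (c - a)%:R * (M / a.+1%:R) ^+ 2.
  move=> ca; under eq_Rintegral do rewrite block_empty// expr0n.
  by rewrite Rintegral_cst// mul0r mulr_ge0// sqr_ge0.
elim: b => [|b IH]; first exact: empty.
have [ba|ab] := ltnP b a; first exact: empty.
have iBB : P.-integrable setT (EFin \o (fun t => block a b t * block a b t)).
  by under eq_fun do rewrite -expr2; exact: integrable_block_square.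
have iBY : P.-integrable setT (EFin \o (fun t => block a b t * Y b t)).
  apply: integrable_boundedM; [exact: measurable_block|exact: bounded_block|..].
    exact: mY.
  exact: bounded_term.
have iYY : P.-integrable setT (EFin \o (fun t => Y b t * Y b t)).
  apply: integrable_boundedM; [exact: mY|exact: bounded_term|exact: mY|].
  exact: bounded_term.
have iBY2 : P.-integrable setT (EFin \o (fun t => 2 * (block a b t * Y b t))).
  exact: (integrableZl measurableT 2 iBY).
have -> : \int[P]_t (block a b.+1 t ^+ 2) = \int[P]_t (block a b t ^+ 2)
    + \int[P]_t (Y b t * Y b t).
  transitivity (\int[P]_t ((block a b t * block a b t
      + 2 * (block a b t * Y b t)) + Y b t * Y b t)).
    apply: eq_Rintegral => t _; rewrite /block big_nat_recr//=.
    by rewrite expr2; ring.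
  rewrite RintegralD//; last exact: (integrableD measurableT iBB iBY2).
  rewrite RintegralD// RintegralZl// block_orthogonal// mulr0 addr0.
  by congr (_ + _); apply: eq_Rintegral => t _; rewrite expr2.
rewrite subSn// -natr1 mulrDl mul1r lerD ?IH//.
apply: le_trans (_ : \int[P]_t ((M / a.+1%:R) ^+ 2) <= _); last first.
  by rewrite Rintegral_cst// [X in _ * X](_ : _ = 1) ?mulr1//= probability_setT.
apply: le_Rintegral => //.
  by apply: (bounded_integrable (M := `|(M / a.+1%:R) ^+ 2|) P measurableT).
move=> t _; rewrite -expr2 -real_normK ?num_real// ler_sqr ?nnegrE ?divr_ge0//.
apply: le_trans (YM b t) _.
by rewrite ler_wpM2l// lef_pV2 ?posrE ?ltr0n// ler_nat ltnS.
Qed.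

Local Lemma weighted_block_second_moment j :
  \int[P]_t (j.+1%:R ^+ 2 * block (j ^ 3) (j.+1 ^ 3) t ^+ 2) <=
  48 * M ^+ 2 * j.+1%:R ^- 2.
Proof.
rewrite RintegralZl//; last exact: integrable_block_square.
have x0 : 0 < j.+1%:R :> R by rewrite ltr0n.
have a0 : 0 < (j ^ 3).+1%:R :> R by rewrite ltr0n.
have := cube_gap R j; have := cube_lower R j; rewrite natrX.
have := block_second_moment (j ^ 3) (j.+1 ^ 3).
have : 0 <= (j.+1 ^ 3 - j ^ 3)%:R :> R by [].
(* x = j + 1, a = j^3 + 1 and g is the length of the block *)
move: (\int[P]_t _) (j.+1%:R : R) ((j ^ 3).+1%:R : R)
  ((j.+1 ^ 3 - j ^ 3)%:R : R) x0 a0 => I x a g x0 a0 g0 hI ha hg.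
have ha' : a^-1 <= 4 / x ^+ 3.
  by rewrite ler_pdivlMr ?exprn_gt0// mulrC ler_pdivrMr.
apply: le_trans (_ : x ^+ 2 * (M ^+ 2 * ((12 / x) * (4 / x ^+ 3))) <= _);
  last first.
  by rewrite le_eqVlt; apply/orP; left; apply/eqP; field; rewrite gt_eqF.
apply: ler_wpM2l; first by rewrite exprn_ge0// ltW.
apply: le_trans hI _.
rewrite (_ : g * _ = M ^+ 2 * ((g / a) * a^-1)); last by field; rewrite gt_eqF.
apply: ler_wpM2l; first exact: sqr_ge0.
by apply: ler_pM => //; rewrite ?divr_ge0 ?invr_ge0// ltW.
Qed.


(** Blocks between consecutive cubes have second moments of order [j ^- 4] by
    orthogonality, so their weighted squares have a finite expected sum, and a
    finite sum almost surely.  Hence the partial sums converge along the cubes,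
    and they have no room to wander between two of them. *)
Lemma ae_cvg_orthogonal_series : {ae P, forall t, cvgn (series (Y ^~ t))}.
Proof.
pose f j t := (j.+1%:R ^+ 2 * block (j ^ 3) (j.+1 ^ 3) t ^+ 2)%:E.
have f0 j t : (0 <= f j t)%E by rewrite lee_fin mulr_ge0 ?sqr_ge0.
have mf j : measurable_fun setT (f j).
  apply/measurable_EFinP; apply: measurable_funM => //.
  by apply: measurable_funX; exact: measurable_block.
have mF : measurable_fun setT (fun t => \sum_(0 <= j <oo) f j t)%E.
  exact: (ge0_emeasurable_sum (P := xpredT)).
have iF : P.-integrable setT (fun t => \sum_(0 <= j <oo) f j t)%E.
  apply/integrableP; split => //.
  under eq_integral do rewrite gee0_abs ?nneseries_ge0//.
  rewrite integral_nneseries//.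
  (* 96 = 48 * 2, with 2 a bound on the sum of the inverse squares *)
  apply: (@le_lt_trans _ _ (96 * M ^+ 2)%:E); last exact: ltry.
  apply: lime_le.
    by apply: is_cvg_nneseries => n _ _; exact: integral_ge0.
  apply: nearW => N.
  apply: (@le_trans _ _ (\sum_(0 <= j < N) 48 * M ^+ 2 * j.+1%:R ^- 2)%:E).
    rewrite -sumEFin; apply: lee_sum => j _.
    rewrite -[leLHS]fineK; last first.
      apply: (integrable_fin_num measurableT).
      exact: (integrableZl measurableT _ (integrable_block_square _ _)).
    by rewrite lee_fin; exact: weighted_block_second_moment.
  rewrite lee_fin -mulr_sumr.
  have := sum_inverse_square R N; have : 0 <= M ^+ 2 by exact: sqr_ge0.
  by nra.
have := integrable_ae measurableT iF; apply: filterS => t /(_ Logic.I) fin_t.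
apply: (cvg_series_cubes (fun k => YM k t)).
apply: (cvg_series_weighted_squares
         (B := fine (\sum_(0 <= j <oo) f j t)%E)) => N.
rewrite -lee_fin fineK// -sumEFin.
by apply: (@nneseries_lim_ge _ (f ^~ t) xpredT 0 N) => n _ _.
Qed.

End OrthogonalSeries.

(** Summation by parts: increments of a bounded sequence, weighted by a
    sequence decreasing to zero, form a convergent series. *)
Lemma cvg_series_weighted_increments (R : realType) (a x : nat -> R) :
  (forall k, a k.+1 <= a k) -> a n @[n --> \oo] --> 0 ->
  (forall k, `|x k| <= 1) ->
  cvgn (series (fun k => a k * (x k.+1 - x k))).
Proof.
move=> a_dec a0 x1.
have a_ge0 n : 0 <= a n.
  have ni : nonincreasing_seq a by apply/nonincreasing_seqP.
  by have := nonincreasing_cvgn_ge ni (cvgP _ a0) n; rewrite (cvg_lim _ a0).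
pose b k := (a k - a k.+1) * x k.+1.
have -> : series (fun k => a k * (x k.+1 - x k)) =
    (fun n => (a n * x n - a 0 * x 0) + series b n).
  apply/funext => n; rewrite /series/=.
  rewrite -[X in X + _](telescope_sumr (fun k => a k * x k))//.
  rewrite -big_split/=; apply: eq_bigr => k _.
  by rewrite /b; ring.
apply: is_cvgD; first apply: is_cvgB; last 2 first.
- exact: is_cvg_cst.
- apply: normed_cvg; apply: nondecreasing_is_cvgn.
    by apply: (@nondecreasing_series _ _ xpredT 0) => n _ _ /=.
  exists (a 0) => _ [N _ <-]; rewrite /series/=.
  apply: le_trans (_ : \sum_(0 <= k < N) (a k - a k.+1) <= _).
    apply: ler_sum => k _; rewrite /b normrM ger0_norm ?subr_ge0//.
    by rewrite ler_piMr// subr_ge0.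
  under eq_bigr do rewrite -opprB.
  by rewrite sumrN telescope_sumr// opprB gerBl.
apply/cvg_ex; exists 0; apply/cvgrPdist_le => e e0.
move/cvgrPdist_le/(_ e e0) : a0; apply: filterS => n; rewrite !sub0r !normrN.
by apply: le_trans; rewrite normrM ler_piMr.
Qed.

(** A convergent series of matrices has uniformly small tails, whatever the
    range [A n] of their upper ends. *)
Lemma sup_tails_cvg0 (R : realType) (m d : nat) (u : nat -> 'M[R]_(m, d))
    (A : nat -> set nat) :
  (forall n, A n n) ->
  (forall i v, cvgn (series (fun k => u k i v))) ->
  ereal_sup [set (norm1 (\sum_(n <= k < r) u k))%:E | r in A n]
    @[n --> \oo] --> 0%:E.
Proof.
move=> An hu.
pose S (iv : 'I_m * 'I_d) := series (fun k => u k iv.1 iv.2).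
have tail e : 0 < e -> \forall n \near \oo, forall r,
    norm1 (\sum_(n <= k < r) u k) <= e.
  move=> e0.
  (* a bound on the number of coordinates, positive in any case *)
  pose N := (m * d).+1%:R : R.
  have N0 : 0 < N by rewrite ltr0n.
  have e2 : 0 < e / (2 * N) by rewrite divr_gt0// mulr_gt0.
  have near_lim : \forall n \near \oo, forall iv,
      `|limn (S iv) - S iv n| <= e / (2 * N).
    apply: filter_forall => iv.
    by move/cvgrPdist_le/(_ _ e2) : (hu iv.1 iv.2).
  case: near_lim => n0 _ hn0; exists n0 => // n /= n0n r.
  have [rn|nr] := ltnP r n.
    rewrite big_geq ?(ltnW rn)// /norm1 big1 ?ltW// => i _.
    by rewrite big1// => v _; rewrite mxE normr0.
  apply: le_trans (_ : \sum_(i < m) \sum_(v < d) e / N <= _).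
    apply: ler_sum => i _; apply: ler_sum => v _.
    have -> : (\sum_(n <= k < r) u k) i v =
        (limn (S (i, v)) - S (i, v) n) - (limn (S (i, v)) - S (i, v) r).
      rewrite summxE [RHS]addrC opprB addrA subrK [RHS]sub_series nr.
      by [].
    apply: le_trans (ler_normB _ _) _.
    have -> : e / N = e / (2 * N) + e / (2 * N) by field; rewrite gt_eqF.
    apply: lerD; first exact: hn0.
    by apply: hn0; exact: leq_trans nr.
  rewrite !sumr_const !card_ord -mulrnA -[leLHS]mulr_natr mulrAC ler_pdivrMr//.
  by apply: ler_wpM2l; [exact: ltW|rewrite ler_nat mulnC leqnSn].
have norm1_ge0 (x : 'M[R]_(m, d)) : 0 <= norm1 x.
  by apply: sumr_ge0 => i _; apply: sumr_ge0.
have sup_ge0 n :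
    (0 <= ereal_sup [set (norm1 (\sum_(n <= k < r) u k))%:E | r in A n])%E.
  apply: le_trans (_ : (norm1 (\sum_(n <= k < n) u k))%:E <= _)%E.
    by rewrite lee_fin.
  by apply: ereal_sup_ubound; exists n.
have sup_le e : 0 < e -> \forall n \near \oo,
    (ereal_sup [set (norm1 (\sum_(n <= k < r) u k))%:E | r in A n] <= e%:E)%E.
  move=> /tail; apply: filterS => n hn.
  by apply: ge_ereal_sup => _ [r _ <-]; rewrite lee_fin.
have sup_fin n e :
    (ereal_sup [set (norm1 (\sum_(n <= k < r) u k))%:E | r in A n] <= e%:E)%E ->
    ereal_sup [set (norm1 (\sum_(n <= k < r) u k))%:E | r in A n] \is a fin_num.
  move=> le_e; rewrite ge0_fin_numE//; apply: le_lt_trans le_e _.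
  exact: ltry.
apply/fine_cvgP; split.
  by apply: filterS (sup_le 1 ltr01) => n; exact: sup_fin.
apply/cvgrPdist_le => e e0; apply: filterS (sup_le e e0) => n le_e /=.
rewrite sub0r normrN ger0_norm ?fine_ge0// -lee_fin fineK//.
exact: sup_fin le_e.
Qed.

(** * Renewal sequences *)

Section Renewal.
Implicit Types g h : nat -> nat.

Definition renewal_time g (k : nat) : nat := (\sum_(j < k) g j)%N.

Definition renewal_at g (n : nat) : Prop :=
  exists2 k, (1 <= k)%N & renewal_time g k = n.

Lemma renewal_timeS g k : renewal_time g k.+1 = (renewal_time g k + g k)%N.
Proof. by rewrite /renewal_time big_ord_recr. Qed.

Lemma leq_renewal_time g : (forall k, 0 < g k)%N ->
  {mono renewal_time g : k l / (k <= l)%N}.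
Proof.
move=> g0; apply: leq_mono; apply: homo_ltn; first exact: ltn_trans.
by move=> k; rewrite renewal_timeS -addn1 leq_add2l.
Qed.

Lemma ltn_renewal_time g : (forall k, 0 < g k)%N ->
  {mono renewal_time g : k l / (k < l)%N}.
Proof. by move=> g0; apply: leqW_mono; exact: leq_renewal_time. Qed.

Lemma renewal_index g n : (forall k, 0 < g k)%N ->
  exists K, (renewal_time g K <= n < renewal_time g K.+1)%N.
Proof.
move=> g0; have ex : exists k, (n < renewal_time g k.+1)%N.
  exists n; elim: n => [|n IH]; rewrite renewal_timeS.
    by rewrite addn_gt0 g0 orbT.
  by apply: (leq_ltn_trans IH); rewrite -addn1 leq_add2l.
case: (ex_minnP ex) => -[|K] lt_n min_K.
  by exists 0%N; rewrite lt_n andbT /renewal_time big_ord0.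
exists K.+1; rewrite lt_n andbT leqNgt; apply/negP => /min_K.
by rewrite ltnn.
Qed.

Lemma eq_renewal_time g h K : (forall l, (l < K)%N -> h l = g l) ->
  forall k, (k <= K)%N -> renewal_time h k = renewal_time g k.
Proof.
by move=> hg k kK; apply: eq_bigr => l _; rewrite hg// (leq_trans _ kK).
Qed.

(** Renewal times increase strictly, so their set up to time [n] determines them
    in order: it reveals the completed waiting times and that the current one
    exceeds the elapsed part, and nothing more. *)
Lemma renewals_upto g h n K :
  (forall k, 0 < g k)%N -> (forall k, 0 < h k)%N ->
  (renewal_time g K <= n < renewal_time g K.+1)%N ->
  (forall l, (l <= n)%N -> (renewal_at h l <-> renewal_at g l)) <->
  (forall l, (l < K)%N -> h l = g l) /\ (n < renewal_time g K + h K)%N.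
Proof.
move=> g0 h0 /andP[Kn nK].
have leg := leq_renewal_time g0; have leh := leq_renewal_time h0.
have ltg := ltn_renewal_time g0; have lth := ltn_renewal_time h0.
split=> [same|[hg nh] l ln].
- have eq_t k : (k <= K)%N -> renewal_time h k = renewal_time g k.
    elim: k => [_|k IH kK]; first by rewrite /renewal_time !big_ord0.
    have {}IH := IH (ltnW kK).
    have gn : (renewal_time g k.+1 <= n)%N by rewrite (leq_trans _ Kn)// leg.
    have [k1 _ hk1] : renewal_at h (renewal_time g k.+1).
      by apply/same => //; exists k.+1.
    have hg1 : (renewal_time h k.+1 <= renewal_time g k.+1)%N.
      by rewrite -hk1 leh -lth hk1 IH ltg.
    have [k2 _ gk2] : renewal_at g (renewal_time h k.+1).
      by apply/same; [exact: leq_trans gn|exists k.+1].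
    apply/eqP; rewrite eqn_leq hg1/=.
    by rewrite -gk2 leg -ltg gk2 -IH lth.
  split=> [l lK|].
    have := eq_t _ lK; rewrite !renewal_timeS eq_t ?(ltnW lK)//.
    by move/addnI.
  rewrite ltnNge -(eq_t K)// -renewal_timeS; apply/negP => hn.
  have [k _ gk] : renewal_at g (renewal_time h K.+1).
    by apply/same => //; exists K.+1.
  have : (renewal_time g K < renewal_time g k)%N by rewrite gk -(eq_t K)// lth.
  rewrite ltg -leg gk => /leq_trans/(_ hn).
  by rewrite leqNgt nK.
- have eq_t := eq_renewal_time hg.
  have nhK : (n < renewal_time h K.+1)%N by rewrite renewal_timeS eq_t.
  split=> -[k k1 tk]; exists k => //.
  + rewrite -eq_t// leqNgt; apply/negP; rewrite -leh tk => /(leq_trans nhK).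
    by rewrite ltnNge ln.
  + rewrite eq_t// leqNgt; apply/negP; rewrite -leg tk => /(leq_trans nK).
    by rewrite ltnNge ln.
Qed.

Lemma renewal_next g h n K :
  (forall k, 0 < g k)%N -> (forall k, 0 < h k)%N ->
  (renewal_time g K <= n < renewal_time g K.+1)%N ->
  (forall l, (l < K)%N -> h l = g l) -> (n < renewal_time g K + h K)%N ->
  renewal_at h n.+1 <-> (renewal_time g K + h K = n.+1)%N.
Proof.
move=> g0 h0 /andP[Kn nK] hg nh.
have eq_t := eq_renewal_time hg.
have leh := leq_renewal_time h0; have lth := ltn_renewal_time h0.
rewrite -(eq_t K)// -renewal_timeS; split => [[k _ tk]|tK]; last by exists K.+1.
have nhK : (n < renewal_time h K.+1)%N by rewrite renewal_timeS (eq_t K).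
by apply/eqP; rewrite eqn_leq nhK andbT -tk leh -lth tk ltnS (eq_t K).
Qed.

End Renewal.

(** * The walks and their clocks *)

Section Walks.
Context (disp : measure_display) (Omega : measurableType disp) (m d : nat).
Context (R : realType) (P : probability Omega R).
Context (alpha : 'M[R]_(m, d)) (p : 'I_m -> R)
  (pi : 'M[R]_(m, d) -> 'M[R]_(m, d)).
Context (W : 'I_m -> nat -> Omega -> 'I_d) (G : 'I_m -> nat -> Omega -> nat).
Context (hW : interacting_vrrw W G P alpha p pi).

Local Notation prob := (prob P).

(** The past is encoded in finite types, so that averaging over it is a finite
    sum. *)
Definition walk_trace (n : nat) (omega : Omega) :
  {ffun 'I_m * 'I_n.+1 -> 'I_d} :=
  [ffun jl : 'I_m * 'I_n.+1 => W jl.1 jl.2 omega].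

Definition clock_trace (n : nat) (omega : Omega) :
  {ffun 'I_m * 'I_n.+1 -> bool} :=
  [ffun jl : 'I_m * 'I_n.+1 => `[< transition_at G jl.1 jl.2 omega >]].

Definition clock_atom n omega : set Omega :=
  clock_trace n @^-1` [set clock_trace n omega].

Lemma eq_walk_trace n omega omega' :
  walk_trace n omega' = walk_trace n omega <->
  forall j l, (l <= n)%N -> W j l omega' = W j l omega.
Proof.
split=> [/ffunP h j l ln|h]; last first.
  by apply/ffunP => -[j l]; rewrite !ffunE h ?leq_ord.
by have := h (j, Ordinal (ln : (l < n.+1)%N)); rewrite !ffunE.
Qed.

Lemma eq_clock_trace n omega omega' :
  clock_trace n omega' = clock_trace n omega <->
  forall j l, (l <= n)%N ->
    transition_at G j l omega' <-> transition_at G j l omega.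
Proof.
split=> [/ffunP h j l ln|h].
  have := h (j, Ordinal (ln : (l < n.+1)%N)); rewrite !ffunE/= => /eqP.
  by move/eqP => e; split => /asboolP; [rewrite e|rewrite -e] => /asboolP.
apply/ffunP => -[j l]; rewrite !ffunE; apply: asbool_equiv_eq.
exact: h (leq_ord l).
Qed.

Lemma historyE n omega : history W G n omega =
  walk_trace n @^-1` [set walk_trace n omega] `&` clock_atom n omega.
Proof.
apply/seteqP; split => [t h|t [/eq_walk_trace h1 /eq_clock_trace h2] j l ln].
  by split; [apply/eq_walk_trace|apply/eq_clock_trace] => j l /(h j)[].
by split; [exact: h1|exact: h2].
Qed.

Lemma clock_atomS n omega : clock_atom n.+1 omega `<=` clock_atom n omega.
Proof.
move=> t /eq_clock_trace h; apply/eq_clock_trace => j l ln.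
by apply: h; exact: leqW.
Qed.

Lemma historyS n omega : history W G n.+1 omega =
  positions W n.+1 (fun j => W j n.+1 omega) `&` history W G n omega
  `&` clock_atom n.+1 omega.
Proof.
apply/seteqP; split => [t h|t [[pos h] /eq_clock_trace c] j l].
  split; last by apply/eq_clock_trace => j l /(h j)[].
  by split => [j|j l ln]; [have [] := h j _ (leqnn _)|exact: h (leqW ln)].
rewrite leq_eqVlt => /orP[/eqP ->|ln]; last exact: h.
by split; [exact: pos|exact: c].
Qed.

Lemma clock_sigma : sigma_algebra setT (clock_events G).
Proof. exact: smallest_sigma_algebra. Qed.

Lemma clock_measurable C : clock_events G C -> measurable C.
Proof.
apply: smallest_sub; first exact: sigma_algebra_measurable.
by move=> _ [j [k [g ->]]]; exact: vrrw_measurableG hW j k g.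
Qed.

Lemma discrete_clock j k : discrete_in (clock_events G) (G j k).
Proof. by move=> g; apply: sub_sigma_algebra; exists j, k, g. Qed.

Lemma discrete_transition_time j k :
  discrete_in (clock_events G) (transition_time G j k).
Proof.
elim: k => [|k IH] n.
  apply: (discrete_saturated clock_sigma (discrete_clock j 0)) => s t _.
  by rewrite /transition_time !big_ord0.
apply: (discrete_saturated clock_sigma
          (discrete_pair clock_sigma IH (discrete_clock j k))) => s t.
by rewrite /transition_time !big_ord_recr/= => -[-> ->].
Qed.

Lemma transition_at_clock j n : clock_events G (transition_at G j n).
Proof.
have [_ _ Gcup] := clock_sigma.
rewrite (_ : transition_at G j n =
  \bigcup_k (transition_time G j k.+1 @^-1` [set n])).
  by apply: Gcup => k; exact: discrete_transition_time.
apply/seteqP; split => [t [[//|k] _ tk]|t [k _ tk]]; first by exists k.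
by exists k.+1.
Qed.

Lemma discrete_clock_trace n : discrete_in (clock_events G) (clock_trace n).
Proof.
apply: (discrete_ffun clock_sigma) => -[j l] /= b.
have tc := transition_at_clock j l.
rewrite (_ : _ @^-1` _ =
    if b then transition_at G j l else ~` transition_at G j l).
  by case: b => //; exact: (sigma_setC clock_sigma tc).
apply/seteqP; split => t /=; case: asboolP; by case: b.
Qed.

Lemma discrete_walk_trace n : discrete_in measurable (walk_trace n).
Proof.
apply: (discrete_ffun (@sigma_algebra_measurable _ Omega)) => -[j l] v.
exact: vrrw_measurableW hW _ _ _.
Qed.

Lemma measurable_walk j n : discrete_in measurable (W j n).
Proof. by move=> v; exact: vrrw_measurableW hW _ _ _. Qed.

Lemma measurable_transition_at j n : measurable (transition_at G j n).
Proof. by apply: clock_measurable; exact: transition_at_clock. Qed.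

Lemma clock_atom_clock n omega : clock_events G (clock_atom n omega).
Proof. exact: discrete_clock_trace. Qed.

Lemma measurable_history n omega : measurable (history W G n omega).
Proof.
rewrite historyE; apply: measurableI; first exact: discrete_walk_trace.
by apply: clock_measurable; exact: clock_atom_clock.
Qed.

Lemma measurable_positions n w : measurable (positions W n w).
Proof.
have -> : positions W n w = (fun t => [ffun j => W j n t] : {ffun 'I_m -> 'I_d})
    @^-1` [set [ffun j => w j]].
  apply/seteqP; split => t /= h; first by apply/ffunP => j; rewrite !ffunE h.
  by move=> j; have /ffunP/(_ j) := h; rewrite !ffunE.
apply: (discrete_ffun (@sigma_algebra_measurable _ Omega)) => j.
exact: measurable_walk.
Qed.

Lemma step_clocks n omega w C : clock_events G C ->
  prob (positions W n.+1 w `&` history W G n omega `&` C) *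
    prob (history W G n omega) =
  prob (positions W n.+1 w `&` history W G n omega) *
    prob (history W G n omega `&` C).
Proof.
move=> hC; have mC := clock_measurable hC.
have mH := measurable_history n omega; have mw := measurable_positions n.+1 w.
have := vrrw_step_clocks hW n omega w hC.
rewrite !probE//; last 3 first.
- exact: measurableI.
- exact: measurableI.
- by apply: measurableI => //; exact: measurableI.
rewrite -!EFinM; exact: EFin_inj.
Qed.

(** The clocks run autonomously, so the past of the walks acts on clock events
    only through the transitions already observed. *)
Lemma history_clock_factor n omega : exists c, forall C, clock_events G C ->
  prob (history W G n omega `&` C) = c * prob (clock_atom n omega `&` C).
Proof.
have hK := clock_atom_clock.
elim: n => [|n [c IH]].
  pose w j := W j 0 omega.
  exists (prob (positions W 0 w)) => C hC.
  have hKC := sigma_setI clock_sigma (hK 0 omega) hC.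
  have -> : history W G 0 omega `&` C =
      positions W 0 w `&` (clock_atom 0 omega `&` C).
    rewrite historyE -setIA; congr (_ `&` _); apply/seteqP; split => t /=.
      by move/eq_walk_trace => h j; exact: h.
    by move=> h; apply/eq_walk_trace => j l; rewrite leqn0 => /eqP ->; exact: h.
  have := vrrw_init_clocks hW w hKC; have mKC := clock_measurable hKC.
  have mw := measurable_positions 0 w.
  rewrite !probE//; last exact: measurableI.
  rewrite -EFinM; exact: EFin_inj.
have mH := measurable_history n omega.
pose w j := W j n.+1 omega; have mw := measurable_positions n.+1 w.
have hS C : history W G n.+1 omega `&` C = positions W n.+1 w `&`
    history W G n omega `&` (clock_atom n.+1 omega `&` C).
  by rewrite historyS setIA.
have [H0|H0] := eqVneq (prob (history W G n omega)) 0.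
  exists 0 => C hC; rewrite mul0r hS; apply: (prob_eq0S _ _ _ H0) => //.
    apply: measurableI; first exact: measurableI.
    by apply: clock_measurable; exact: (sigma_setI clock_sigma).
  by move=> t [[]].
exists (prob (positions W n.+1 w `&` history W G n omega) /
        prob (history W G n omega) * c) => C hC.
have hKC := sigma_setI clock_sigma (hK n.+1 omega) hC.
apply: (mulIf H0); rewrite hS step_clocks// IH//.
rewrite setIA (setIidr (@clock_atomS n omega)).
by field.
Qed.

Lemma geometric_tail i k a :
  P [set omega | (a < G i k omega)%N] = ((1 - p i) ^+ a)%:E.
Proof.
have mG (B : set nat) : measurable (G i k @^-1` B).
  apply: (discrete_preimage (@sigma_algebra_measurable _ Omega)) => g.
  exact: vrrw_measurableG hW _ _ _.
rewrite probE//; last exact: (mG [set g | (a < g)%N]).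
congr EFin; elim: a => [|a IH].
  rewrite (_ : [set _ | _] = setT) ?expr0.
    by rewrite /prob probability_setT.
  by apply/seteqP; split => // t _; exact: vrrw_clock_pos hW _ _ _.
have := probDI P (mG [set g | (a < g)%N]) (mG [set a.+1]).
rewrite [prob (G i k @^-1` _)]IH.
rewrite (_ : _ `&` _ = [set t | G i k t = a.+1]); last first.
  by apply/seteqP; split => [t []//|t /= ->].
rewrite (prob_eq (vrrw_clock_law hW i k a)).
rewrite (_ : _ `&` _ = [set t | (a.+1 < G i k t)%N]); last first.
  apply/seteqP; split => t /=; last by move=> h; split; [exact: ltnW|lia].
  by case=> h1 h2; rewrite ltn_neqAle h1 andbT eq_sym; apply/eqP.
by move=> h; rewrite exprS; lra.
Qed.

(** Lack of memory: the two events differ by the factor of the current waiting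
    time of walk [i], which is known to exceed the time elapsed. *)
Lemma clock_atom_next i n omega :
  P (clock_atom n omega `&` transition_at G i n.+1) =
  ((p i)%:E * P (clock_atom n omega))%E.
Proof.
have G0 j t k : (0 < G j k t)%N by exact: vrrw_clock_pos hW _ _ _.
have /choice[K hK] : forall j, exists K,
    (renewal_time (G j ^~ omega) K <= n < renewal_time (G j ^~ omega) K.+1)%N.
  by move=> j; apply: renewal_index => k; exact: G0.
pose tK j := renewal_time (G j ^~ omega) (K j).
(* The clock atom prescribes the completed waiting times and bounds the current
   one from below; B' differs from B in prescribing the current one for i. *)
pose B (x : 'I_m * nat) : set nat :=
  if (x.2 < K x.1)%N then [set G x.1 x.2 omega]
  else [set g | (n < tK x.1 + g)%N].
pose B' x := if x == (i, K i) then [set g | (tK i + g = n.+1)%N] else B x.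
pose s := [seq (j, l) | j <- enum 'I_m, l <- iota 0 (K j).+1].
have sP j l : ((j, l) \in s) = (l <= K j)%N.
  apply/allpairsPdep/idP => [[j' [l' [_ + [-> ->]]]]|lK].
    by rewrite mem_iota add0n.
  by exists j, l; rewrite mem_enum mem_iota add0n.
have us : uniq s.
  apply: allpairs_uniq_dep; first exact: enum_uniq.
    by move=> j _; exact: iota_uniq.
  by move=> [j l] [j' l'] _ _ /= [-> ->].
have atomP t : clock_atom n omega t <-> forall j,
    (forall l, (l < K j)%N -> G j l t = G j l omega) /\
    (n < tK j + G j (K j) t)%N.
  split=> [/eq_clock_trace h j|h].
    apply/(renewals_upto (h := G j ^~ t) _ _ (hK j));
      try by move=> k; exact: G0.
    exact: h.
  apply/eq_clock_trace => j; have := h j.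
  by move/(renewals_upto (h := G j ^~ t) _ _ (hK j)); apply=> k; exact: G0.
have atomE : clock_atom n omega =
    \big[setI/setT]_(x <- s) (G x.1 x.2 @^-1` B x).
  rewrite -bigcap_seq; apply/seteqP; split => t.
    move/atomP => h [j l] /=; rewrite sP /B /= leq_eqVlt.
    have [h1 h2] := h j.
    by case: ltnP => [lK _|_ /orP[/eqP ->|//]] //=; exact: h1.
  move=> h; apply/atomP => j; split=> [l lK|].
    by have := h (j, l); rewrite /= sP /B /= lK; apply; exact: ltnW.
  by have := h (j, K j); rewrite /= sP /B /= ltnn; apply.
have nextE : clock_atom n omega `&` transition_at G i n.+1 =
    \big[setI/setT]_(x <- s) (G x.1 x.2 @^-1` B' x).
  rewrite -bigcap_seq; apply/seteqP; split => t.
    move=> [at_t tr] x xs; rewrite /B' /=; case: eqVneq => [->|_] /=.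
      have /atomP/(_ i)[h1 h2] := at_t.
      by apply/(renewal_next (h := G i ^~ t) _ _ (hK i)) => // k; exact: G0.
    by move: at_t; rewrite atomE -bigcap_seq; apply.
  move=> h; have tKi : (tK i + G i (K i) t = n.+1)%N.
    by have := h (i, K i); rewrite /= sP /B' eqxx; apply.
  have at_t : clock_atom n omega t.
    rewrite atomE -bigcap_seq => x /h; rewrite /B' /=.
    by case: eqVneq => [-> /= |//]; rewrite /B /= ltnn /= => _; rewrite tKi.
  split=> //; have /atomP/(_ i)[h1 h2] := at_t.
  by apply/(renewal_next (h := G i ^~ t) _ _ (hK i)) => // k; exact: G0.
have iK : (i, K i) \in s by rewrite sP.
have indep := vrrw_clock_indep hW.
rewrite nextE atomE !(indep _ _ us) !(bigD1_seq _ iK us)/= muleA.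
congr (_ * _)%E.
  have /andP[tn _] := hK i; rewrite -/(tK i) in tn.
  rewrite /B' /B /= eqxx ltnn.
  rewrite (_ : _ @^-1` _ = [set t | G i (K i) t = (n - tK i).+1]); last first.
    by apply/seteqP; split => t /=; lia.
  rewrite (vrrw_clock_law hW).
  rewrite [X in (_ * P X)%E](_ : _ = [set t | (n - tK i < G i (K i) t)%N]).
    by rewrite geometric_tail -EFinM.
  by apply/seteqP; split => t /=; lia.
by apply: eq_bigr => x /negbTE xi; rewrite /B' xi.
Qed.

(** The walks see no more of the clocks than their past, so that the coin toss
    of [clock_atom_next] is also independent of the history and of the next
    positions. *)
Lemma transition_given_history i n omega w :
  prob (positions W n.+1 w `&` history W G n omega `&` transition_at G i n.+1) =
  p i * prob (positions W n.+1 w `&` history W G n omega).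
Proof.
have mH := measurable_history n omega.
have mw := measurable_positions n.+1 w.
have hT := transition_at_clock i n.+1.
have mT := clock_measurable hT.
have [H0|H0] := eqVneq (prob (history W G n omega)) 0.
  have H0' A : measurable A -> A `<=` history W G n omega -> prob A = 0.
    by move=> mA AH; exact: (prob_eq0S mA mH AH H0).
  have mwH : measurable (positions W n.+1 w `&` history W G n omega).
    exact: measurableI.
  rewrite (H0' _ mwH) => [|t []//]; rewrite H0' ?mulr0 => [//||t [[]]//].
  exact: measurableI.
have [c hc] := history_clock_factor n omega.
have HE : prob (history W G n omega) = c * prob (clock_atom n omega).
  rewrite -[in LHS](setIT (history _ _ _ _)) hc ?setIT//.
  exact: sigma_setT clock_sigma.
have mK := clock_measurable (clock_atom_clock n omega).
have nextE : prob (clock_atom n omega `&` transition_at G i n.+1) =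
    p i * prob (clock_atom n omega).
  by apply: prob_eq; rewrite clock_atom_next probE// EFinM.
apply: (mulIf H0); rewrite step_clocks// hc// nextE HE.
by ring.
Qed.

(** * The transition probabilities of the walks *)

Definition walk_atom (n : nat) (omega : Omega) : set Omega :=
  walk_trace n @^-1` [set walk_trace n omega].

Lemma measurable_walk_atom n omega : measurable (walk_atom n omega).
Proof. exact: discrete_walk_trace _ _. Qed.

Lemma walk_atomS n omega : walk_atom n.+1 omega =
  positions W n.+1 (fun j => W j n.+1 omega) `&` walk_atom n omega.
Proof.
apply/seteqP; split => [t /eq_walk_trace h|t [pos /eq_walk_trace h]].
  split=> [j|]; first exact: h.
  by apply/eq_walk_trace => j l ln; apply: h; exact: leqW.
apply/eq_walk_trace => j l; rewrite leq_eqVlt => /orP[/eqP ->|ln].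
  exact: pos.
exact: h.
Qed.

Lemma eq_occupation n omega omega' :
  walk_trace n omega' = walk_trace n omega ->
  occupation W R n omega' = occupation W R n omega.
Proof.
move=> /eq_walk_trace h; congr (_ *: _); apply: eq_bigr => l _.
by apply/matrixP => j v; rewrite !mxE h// leq_ord.
Qed.

Lemma discrete_clock_trace_measurable n :
  discrete_in measurable (clock_trace n).
Proof. by move=> e; apply: clock_measurable; exact: discrete_clock_trace. Qed.

(** The transitions before time [n.+1] are averaged out. *)
Lemma transition_given_walks i n omega :
  prob (walk_atom n.+1 omega `&` transition_at G i n.+1) =
  p i * prob (walk_atom n.+1 omega).
Proof.
have mA := measurable_walk_atom n.+1 omega.
have mT := measurable_transition_at i n.+1.
have hc := discrete_clock_trace_measurable (n := n).
rewrite (prob_fibres P hc (measurableI _ _ mA mT)) (prob_fibres P hc mA).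
rewrite mulr_sumr.
apply: eq_bigr => e _; rewrite setIAC.
have [[t [At te]]|none] := pselect (exists t, walk_atom n.+1 omega t /\
    clock_trace n t = e); last first.
  rewrite (_ : walk_atom n.+1 omega `&` _ @^-1` _ = set0).
    by rewrite set0I prob_set0 mulr0.
  by apply/seteqP; split => // t [At /= te]; apply: none; exists t.
have -> : walk_atom n.+1 omega `&` clock_trace n @^-1` [set e] =
    positions W n.+1 (fun j => W j n.+1 t) `&` history W G n t.
  by rewrite historyE setIA /clock_atom te -walk_atomS /walk_atom At.
exact: transition_given_history.
Qed.

Lemma move_given_walks i n omega v :
  prob ([set t | W i n.+1 t = v] `&`
      (walk_atom n omega `&` transition_at G i n)) =
  pi (occupation W R n omega) i v *
    prob (walk_atom n omega `&` transition_at G i n).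
Proof.
have mA := measurable_walk_atom n omega.
have mT := measurable_transition_at i n.
have mv : measurable [set t | W i n.+1 t = v] := measurable_walk i n.+1 v.
have mAT := measurableI _ _ mA mT.
have hc := discrete_clock_trace_measurable (n := n).
rewrite (prob_fibres P hc (measurableI _ _ mv mAT)) (prob_fibres P hc mAT).
rewrite mulr_sumr.
apply: eq_bigr => e _; rewrite -setIA.
have [[t [[At Tt] te]]|none] := pselect (exists t, (walk_atom n omega t /\
    transition_at G i n t) /\ clock_trace n t = e); last first.
  rewrite (_ : _ `&` _ `&` _ @^-1` _ = set0).
    by rewrite setI0 prob_set0 mulr0.
  by apply/seteqP; split => // t [ATt /= te]; apply: none; exists t.
have -> : walk_atom n omega `&` transition_at G i n `&`
    clock_trace n @^-1` [set e] = history W G n t.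
  rewrite historyE -/(walk_atom n t) /clock_atom te /walk_atom At.
  apply/seteqP; split => [s [[]]//|s [As /= se]]; split => //; split => //.
  by move: se; rewrite -te => /eq_clock_trace h; apply/h.
apply: prob_eq; rewrite (vrrw_move hW v Tt) (eq_occupation At).
by rewrite probE ?EFinM//; exact: measurable_history _ _.
Qed.

(** A transition occurs at time [n] with probability [p i] whatever the walks
    did until then; the walk moves according to [pi] if there is one and stays
    otherwise.  Time 0 is never a transition time, hence [1 <= n]. *)
Lemma step_given_walks i n omega v : (1 <= n)%N ->
  prob ([set t | W i n.+1 t = v] `&` walk_atom n omega) =
  (p i * pi (occupation W R n omega) i v + (1 - p i) * (W i n omega == v)%:R) *
    prob (walk_atom n omega).
Proof.
case: n => // n _; set A := walk_atom n.+1 omega.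
have mA : measurable A := measurable_walk_atom n.+1 omega.
have mT := measurable_transition_at i n.+1.
have mv : measurable [set t | W i n.+2 t = v] := measurable_walk i n.+2 v.
rewrite (probDI P (measurableI _ _ mv mA) mT) -!setIA move_given_walks.
have AT := transition_given_walks i n omega; rewrite -/A in AT *.
have ANT : prob (A `&` ~` transition_at G i n.+1) = (1 - p i) * prob A.
  by have := probDI P mA mT; rewrite AT; lra.
have -> : prob ([set t | W i n.+2 t = v] `&`
      (A `&` ~` transition_at G i n.+1)) =
    (W i n.+1 omega == v)%:R * prob (A `&` ~` transition_at G i n.+1).
  have stay t : A t -> ~ transition_at G i n.+1 t ->
      W i n.+2 t = W i n.+1 omega.
    move=> /eq_walk_trace At nT; rewrite (vrrw_stay hW nT).
    exact: At.
  case: eqP => [Wv|Wv]; rewrite ?mul1r ?mul0r.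
    congr prob; apply/seteqP; split => [t []//|t [At nT]].
    by split => //=; rewrite stay.
  rewrite (_ : _ `&` _ = set0) ?prob_set0//.
  by apply/seteqP; split => // t [/= tv [At nT]]; apply: Wv; rewrite -tv stay.
by rewrite AT ANT; ring.
Qed.

Definition innovation i v (n : nat) (omega : Omega) : R :=
  (W i n.+1 omega == v)%:R - (1 - p i) * (W i n omega == v)%:R
    - p i * pi (occupation W R n omega) i v.

Lemma eq_innovation i v k n s t :
  (k < n)%N -> walk_trace n s = walk_trace n t ->
  innovation i v k s = innovation i v k t.
Proof.
move=> kn /eq_walk_trace h.
rewrite /innovation (h i k.+1)// (h i k) ?(ltnW kn)//.
rewrite (eq_occupation (omega := t))//; apply/eq_walk_trace => j l lk.
by apply: h; rewrite (leq_trans lk)// ltnW.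
Qed.

Lemma measurable_innovation i v n : measurable_fun setT (innovation i v n).
Proof.
move=> _ Y _; rewrite setTI.
apply: (discrete_saturated (@sigma_algebra_measurable _ Omega)
          (discrete_walk_trace (n := n.+1))) => s t.
exact: eq_innovation.
Qed.

Hypotheses (hp : forall i, 0 < p i <= 1)
  (hpi : forall x, simplex_prod x -> simplex_prod (pi x)).

Lemma simplex_occupation n omega : simplex_prod (occupation W R n omega).
Proof.
move=> i; have occ v : occupation W R n omega i v =
    n.+1%:R^-1 * \sum_(l < n.+1) (W i l omega == v)%:R.
  by rewrite !mxE summxE; congr (_ * _); apply: eq_bigr => l _; rewrite mxE.
have n0 : n.+1%:R != 0 :> R by rewrite pnatr_eq0.
split=> [v|].
  rewrite occ mulr_ge0 ?invr_ge0 ?sumr_ge0//=.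
  rewrite mulrC ler_pdivrMr ?ltr0n// mul1r.
  apply: le_trans (_ : \sum_(l < n.+1) 1 <= _);
    last by rewrite sumr_const card_ord.
  by apply: ler_sum => l _; case: eqP.
under eq_bigr do rewrite occ.
rewrite -mulr_sumr exchange_big/= (eq_bigr (fun=> 1)).
  by rewrite sumr_const card_ord mulVf.
move=> l _; rewrite (bigD1 (W i l omega))//= eqxx big1 ?addr0// => v.
by rewrite eq_sym => /negbTE ->.
Qed.

Lemma innovation_le1 i v n omega : `|innovation i v n omega| <= 1.
Proof.
have [/(_ v)/andP[pi0 pi1] _] := hpi (simplex_occupation n omega) i.
have /andP[p0 p1] := hp i; rewrite /innovation ler_norml.
set q := p i * pi _ i v.
have q0 : 0 <= q by rewrite mulr_ge0// ltW.
have qp : q <= p i by rewrite /q ler_piMr// ltW.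
by do 2 case: (_ == v); rewrite ?mulr1n ?mulr0n; apply/andP; split; lra.
Qed.

Lemma innovation_mean0 i v n e : (1 <= n)%N ->
  \int[P]_(t in walk_trace n @^-1` [set e]) innovation i v n t = 0.
Proof.
move=> n1.
have [[s hs]|ne] := pselect (exists s, walk_trace n s = e); last first.
  rewrite (_ : _ @^-1` _ = set0) ?Rintegral_set0//.
  by apply/seteqP; split => // t /= ht; apply: ne; exists t.
rewrite -hs -/(walk_atom n s).
set c := p i * pi (occupation W R n s) i v + (1 - p i) * (W i n s == v)%:R.
have mA := measurable_walk_atom n s.
have mv : measurable [set t | W i n.+1 t = v] := measurable_walk i n.+1 v.
rewrite (eq_Rintegral _ (g := fun t => \1_[set t | W i n.+1 t = v] t - c));
  last first.
  move=> t /[1!inE] /= At; rewrite /innovation (eq_occupation At).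
  move/eq_walk_trace: At => /(_ i n (leqnn n)) ->; rewrite /c indicE.
  have -> : (t \in [set t | W i n.+1 t = v]) = (W i n.+1 t == v).
    by apply/idP/eqP; rewrite in_setE.
  by lra.
rewrite RintegralB//.
- rewrite Rintegral_indic// Rintegral_cst// -/(prob _) step_given_walks//.
  by rewrite subrr.
- apply: (bounded_integrable (M := 1) P mA) => [|t]; last exact: indic_le1.
  exact: measurable_indic.
- by apply: (bounded_integrable (M := `|c|) P mA).
Qed.

(** Innovations are martingale differences for the filtration of the walks, the
    earlier one being a function of the positions up to time [n]. *)
Lemma innovation_orthogonal i v k n : (k < n)%N ->
  \int[P]_t (innovation i v k t * innovation i v n t) = 0.
Proof.
move=> kn; apply: (Rintegral_mul_eq0 (discrete_walk_trace (n := n))).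
- exact: measurable_innovation.
- by exists 1 => t; exact: innovation_le1.
- exact: measurable_innovation.
- by exists 1 => t; exact: innovation_le1.
- by move=> s t; exact: eq_innovation.
- by move=> e; apply: innovation_mean0; exact: leq_ltn_trans kn.
Qed.

(** * Convergence of the weighted noise *)

Let visit i v n omega : R := (W i n omega == v)%:R.

(** The noise is not a sequence of martingale differences, since a walk waits
    between its transitions, but it is one up to a telescoping term. *)
Lemma noise_decomposition i v n omega :
  p i * noise W pi n.+1 omega i v =
  innovation i v n omega
    - (1 - p i) * (visit i v n.+1 omega - visit i v n omega).
Proof. by rewrite /noise /innovation /visit !mxE/=; ring. Qed.

Lemma step_size_dec k : step_size R k.+1 <= step_size R k.
Proof. by rewrite /step_size lef_pV2 ?posrE ?ltr0n// ler_nat. Qed.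

Lemma step_size_ge0 k : 0 <= step_size R k.
Proof. by rewrite invr_ge0. Qed.

Lemma cvg_step_size : step_size R n @[n --> \oo] --> 0.
Proof.
have := @cvg_harmonic R; rewrite -(cvg_shiftn 1).
rewrite (_ : step_size R = fun n => harmonic (n + 1)%N)//.
by apply/funext => n; rewrite /harmonic addn1.
Qed.

Lemma ae_cvg_innovations i v : {ae P, forall omega,
  cvgn (series (fun k => step_size R k.+2 * innovation i v k.+1 omega))}.
Proof.
have mI k := measurable_innovation i v k.
have I1 k t := innovation_le1 i v k t.
apply: (ae_cvg_orthogonal_series (M := 1)
  (Y := fun k t => step_size R k.+2 * innovation i v k.+1 t)) => //.
- by move=> k; exact: measurable_funM.
- move=> k t; rewrite normrM ger0_norm ?step_size_ge0// mul1r.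
  apply: le_trans (_ : step_size R k.+2 <= _).
    by rewrite ler_piMr ?step_size_ge0.
  by rewrite /step_size lef_pV2 ?posrE ?ltr0n// ler_nat; lia.
- move=> k n kn.
  under eq_Rintegral do rewrite mulrACA.
  rewrite RintegralZl//; last first.
    apply: (bounded_integrable (M := 1) P measurableT).
      exact: measurable_funM.
    by move=> t; rewrite normrM mulr_ile1.
  by rewrite innovation_orthogonal// mulr0.
Qed.

(** Dividing [noise_decomposition] by [p i], the weighted noise is the sum of
    an almost surely convergent series and of one that converges surely. *)
Lemma ae_cvg_noise i v : {ae P, forall omega,
  cvgn (series (fun k => (step_size R k *: noise W pi k omega) i v))}.
Proof.
apply: filterS (ae_cvg_innovations i v) => t cvgI.
have p0 : p i != 0 by have /andP[/gt_eqF ->] := hp i.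
have cvgV : cvgn (series (fun k => step_size R k.+2 *
    (visit i v k.+2 t - visit i v k.+1 t))).
  apply: (@cvg_series_weighted_increments _ (fun k => step_size R k.+2)
    (fun k => visit i v k.+1 t)).
  - by move=> k; exact: step_size_dec.
  - have := cvg_step_size; rewrite -(cvg_shiftn 2).
    rewrite (_ : (fun k => step_size R k.+2) = fun n => step_size R (n + 2))//.
    by apply/funext => n; rewrite addn2.
  - by move=> k; rewrite /visit; case: (_ == v); rewrite ?normr1 ?normr0.
move/cvg_ex: cvgI => [lI hI]; move/cvg_ex: cvgV => [lV hV].
(* The decomposition is available from index 2 on: no walk moves between the
   times 0 and 1, so that the first innovation is not centred. *)
rewrite -(is_cvg_series_restrict 2); apply/cvg_ex.
exists ((p i)^-1 * (lI - (1 - p i) * lV)); rewrite -(cvg_shiftn 2).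
apply: cvg_trans (cvgM (cvg_cst (p i)^-1)
  (cvgB hI (cvgM (cvg_cst (1 - p i)) hV))).
apply: near_eq_cvg; apply: nearW => n.
rewrite /= /series/= addn2 !big_add1/= !fctE/= !mulr_sumr -sumrB mulr_sumr.
apply: eq_bigr => k _; rewrite mxE; apply: (mulfI p0).
by rewrite mulVKf// [RHS]mulrCA noise_decomposition; ring.
Qed.

End Walks.

Theorem theorem2 (R : realType) (m d : nat) (hm : (1 <= m)%N) (hd : (2 <= d)%N)
  (p : 'I_m -> R) (hp : forall i, 0 < p i <= 1)
  (pi : 'M[R]_(m, d) -> 'M[R]_(m, d))
  (hpi : forall x, simplex_prod x -> simplex_prod (pi x))
  (hF : lipschitz1_on (@simplex_prod R m d) (drift pi))
  (alpha : 'M[R]_(m, d)) (halpha : simplex_prod alpha)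
  (disp : measure_display) (Omega : measurableType disp)
  (P : probability Omega R)
  (W : 'I_m -> nat -> Omega -> 'I_d) (G : 'I_m -> nat -> Omega -> nat)
  (hW : interacting_vrrw W G P alpha p pi)
  (T : R) (hT : 0 < T) :
  {ae P, forall omega,
    ereal_sup [set (norm1 (\sum_(n <= k < r)
                       step_size R k *: noise W pi k omega))%:E
              | r in [set r : nat | 0 <= step_time R r - step_time R n <= T]]
      @[n --> \oo] --> 0%:E}.
Proof.
have cvg_all : {ae P, forall omega, forall iv : 'I_m * 'I_d,
    cvgn (series (fun k => (step_size R k *: noise W pi k omega) iv.1 iv.2))}.
  by apply: filter_forall => -[i v]; exact: (ae_cvg_noise hW).
apply: filterS cvg_all => omega cvg_omega.
apply: (sup_tails_cvg0 (u := fun k => step_size R k *: noise W pi k omega)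
  (A := fun n => [set r | 0 <= step_time R r - step_time R n <= T])).
  by move=> n /=; rewrite subrr lexx ltW.
by move=> i v; exact: cvg_omega (i, v).
Qed.
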